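(* Let $a_1,\ldots,a_m$ be positive integers, with $b_i,q_i$ as in the context, and suppose that $m\ge 3$, or that $m=2$ and $b_1\ge 1$. Let $N$ be an integer with $0\le N\le q_m-1$ and let $N=\sum_{1\le i\le m}d_iq_{i-1}$ be its greedy representation. Put $V_m=V_m(d_1,\ldots,d_m)$, $V_{m-1}=V_{m-1}(d_1,\ldots,d_{m-1})$ and $V_{m-2}=V_{m-2}(d_1,\ldots,d_{m-2})$. Assume that $V_m$ is not a Christoffel word. Let $$\ell=\min\{b_m-d_m,\,d_m\}\quad\text{and}\quad h=\min\{b_{m-1}-d_{m-1},\,d_{m-1}+1\}.$$ Let $B$ be the longest border of $V_m$. (i) If $d_m=b_m$, then $B=V_{m-1}$. (ii) If $1\le d_m\le b_m-1$ and $1\le d_{m-1}\le b_{m-1}-1$, then $B=V_{m-1}^{\ell}$. (iii) If $1\le d_m\le b_m-1$ and $d_{m-1}=0$, then $B=V_{m-1}^{\ell}$, except if $b_m-d_m<d_m$ and the sequence $d_1,\ldots,d_{m-1}$ is not alternating, in which case $B=V_{m-1}^{\ell+1}$. (iv) If $1\le d_m\le b_m-1$ and $d_{m-1}=b_{m-1}$, then $B=V_{m-1}^{\ell}$. (v) If $d_m=0$ and $b_m\ge 2$, then $B=V_{m-1}^{b_m-1}V_{m-2}$. (vi) If $d_m=0$, $b_m=1$ and $b_{m-1}-d_{m-1}\ge 1$, then $B=V_{m-2}^{h}$, except if $m\ge 3$, $d_{m-2}=0$, $b_{m-1}-d_{m-1}<d_{m-1}+1$ and the sequence $d_1,\ldots,d_{m-2}$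 is not alternating, in which case $B=V_{m-2}^{h+1}$. (vii) If $d_m=0$, $b_m=1$ and $d_{m-1}=b_{m-1}$, then $B=V_{m-2}$.
   Context: Words are over $A=\{a,b\}$. A border of a word is a nonempty proper prefix which is also a suffix of this word. Given positive integers $a_1,\ldots,a_m$, put $b_1=a_1-1$ and $b_i=a_i$ for $i\ge 2$; $q_{-1}=0$, $q_0=1$, $q_i=a_iq_{i-1}+q_{i-2}$ for $1\le i\le m$. An expression $N=d_1q_0+\cdots+d_mq_{m-1}$ is a greedy (Ostrowski) representation of $N$ if $0\le d_i\le b_i$ for all $i$, and for all $i\ge2$, $d_i=b_i$ implies $d_{i-1}=0$. Each integer $N$ with $0\le N\le q_m-1$ has a unique greedy representation. For integers $d_i$ with $0\le d_i\le b_i$, define words $V_i=V_i(d_1,\ldots,d_i)$ by $V_{-1}=b$, $V_0=a$, $V_i=V_{i-1}^{\,b_i-d_i}V_{i-2}V_{i-1}^{\,d_i}$ for $i=1,\ldots,m$. A sequence $d_1,\ldots,d_k$ is called alternating if its values are alternately $0$ and $b_i$, i.e. either $d_i=b_i$ for all odd $i\le k$ and $d_i=0$ for all even $i\le k$, or $d_i=0$ for all odd $i\le k$ and $d_i=b_i$ for all even $i\le k$. Write $(u,v)$ for the endomorphism of $A^*$ sending $a\mapsto u$, $b\mapsto v$, and let $G=(a,ab)$, $\widetilde G=(a,ba)$, $D=(ba,b)$, $\widetilde D=(ab,b)$. A lower (resp. upper) Christoffel word is the image of $a$ or $b$ under an element of the monoid of endomorphisms generated by $G$ and $\widetilde D$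 (resp. by $\widetilde G$ and $D$). A Christoffel word is a lower or an upper Christoffel word. *)

(* Defs.v *)
From mathcomp Require Import all_boot.

Set Implicit Arguments.
Unset Strict Implicit.
Unset Printing Implicit Defensive.

(* The alphabet {a, b} is encoded by the two booleans. *)
Definition letter := bool.
Definition la : letter := false.
Definition lb : letter := true.
Definition word := seq letter.

Definition wpow (u : word) (n : nat) : word := flatten (nseq n u).

Definition border (u w : word) : bool :=
  [&& u != [::], prefix u w, u != w & suffix u w].

Definition longest_border (B w : word) : Prop :=
  border B w /\ forall u : word, border u w -> size u <= size B.

(* The sequences a_1, ..., a_m and d_1, ..., d_m are given by functions on nat;
   the values at 0 and beyond m are never used. *)
Definition bcoef (a : nat -> nat) (i : nat) : nat :=
  if i == 1 then (a 1).-1 else a i.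

(* The values q_{-1} = 0 and, below, V_{-1} = b are inlined in the case i = 1. *)
Fixpoint q (a : nat -> nat) (i : nat) : nat :=
  match i with
  | 0 => 1
  | j.+1 => a i * q a j + (match j with 0 => 0 | k.+1 => q a k end)
  end.

Fixpoint V (a d : nat -> nat) (i : nat) : word :=
  match i with
  | 0 => [:: la]
  | j.+1 => wpow (V a d j) (bcoef a i - d i)
            ++ (match j with 0 => [:: lb] | k.+1 => V a d k end)
            ++ wpow (V a d j) (d i)
  end.

Definition greedy_repr (a : nat -> nat) (m N : nat) (d : nat -> nat) : Prop :=
  [/\ N = \sum_(1 <= i < m.+1) d i * q a i.-1,
      (forall i, 1 <= i <= m -> d i <= bcoef a i) &
      (forall i, 2 <= i <= m -> d i = bcoef a i -> d i.-1 = 0)].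

Definition alternating (a d : nat -> nat) (k : nat) : Prop :=
  (forall i, 1 <= i <= k -> d i = if odd i then bcoef a i else 0) \/
  (forall i, 1 <= i <= k -> d i = if odd i then 0 else bcoef a i).

Definition morph (u v : word) (w : word) : word :=
  flatten [seq if x == la then u else v | x <- w].

Definition mG  := morph [:: la] [:: la; lb].
Definition mGt := morph [:: la] [:: lb; la].
Definition mD  := morph [:: lb; la] [:: lb].
Definition mDt := morph [:: la; lb] [:: lb].

Inductive generated2 (f g : word -> word) : (word -> word) -> Prop :=
| gen_id : generated2 f g id
| gen_l : generated2 f g f
| gen_r : generated2 f g g
| gen_comp h1 h2 :
    generated2 f g h1 -> generated2 f g h2 -> generated2 f g (h1 \o h2).

Definition lower_christoffel (w : word) : Prop :=
  exists2 h, generated2 mG mDt h & w = h [:: la] \/ w = h [:: lb].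

Definition upper_christoffel (w : word) : Prop :=
  exists2 h, generated2 mGt mD h & w = h [:: la] \/ w = h [:: lb].

Definition christoffel (w : word) : Prop :=
  lower_christoffel w \/ upper_christoffel w.

(* Main.v *)
Require Import Defs.
From mathcomp Require Import all_boot.
From mathcomp Require Import zify.

(** Write s = b_m - d_m, t = d_m, x = V_{m-1} and y = V_{m-2}, so that
    w = V_m = x^s y x^t.  The products xw and wx agree except that two adjacent
    distinct letters are exchanged: xw = P c c' S and wx = P c' c S
    ([swap_at_V]).  Here P = x^s P' and S = S' x^t, where P' and S' belong to
    the previous level.  Hence w is x-periodic from the left up to the exchanged
    letters, and x-periodic from the right after them.  The factor of w of the
    length of x that ends at the first exchanged letter differs from a conjugate
    of x by one letter; its number of letters b makes its occurrence in w
    unique.  A border of w cannot contain it, so a border that is at least as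
    long as x lies in the periodic parts, commutes with x, and is a power of x
    because x is primitive.  The borders at least as long as x are therefore the
    powers x^j with |x^j| <= |P| and |x^j| <= |S| ([swap_at_border],
    [longest_border_wpow]).

    It remains to compute lengths.  One has |S| = N and
    |P| + |S| + 2 = |x| + |w|, and the greedy condition gives |S'| < |x|, so x
    fits t times into S.  It fits s times into P, or s + 1 times when
    |P'| >= |x|; by the uniqueness of the greedy representation of q_{m-2} - 1
    this means that d_{m-1} = 0 and d_1, ..., d_{m-1} do not alternate
    ([long_leftP]).  This settles the cases with d_m > 0.  If d_m = 0 and
    b_m = 1, then w = xy is of the form y^{s'} z y^{t'+1} with z = V_{m-3}, and
    the same computation applies to y and w.  If d_m = 0 and b_m > 1, then S is
    so short that w is a prefix of a power of the primitive word x, and its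
    longest border is w without its first x ([longest_border_periodic]).

    Alternating digits, the remaining obstruction in the cases where s, s' or t
    vanishes, are excluded because they produce Christoffel words
    ([alternating_christoffel]). *)

Set Implicit Arguments.
Unset Strict Implicit.
Unset Printing Implicit Defensive.

Implicit Types (u v w x y P S : seq bool) (a d : nat -> nat) (i j k m n : nat).

(** * Powers, prefixes and commuting words *)

Lemma wpowS u n : wpow u n.+1 = u ++ wpow u n.
Proof. by []. Qed.

Lemma wpowD u m n : wpow u (m + n) = wpow u m ++ wpow u n.
Proof. by rewrite /wpow nseqD flatten_cat. Qed.

Lemma wpow1 u : wpow u 1 = u.
Proof. exact: cats0. Qed.

Lemma wpowSr u n : wpow u n.+1 = wpow u n ++ u.
Proof. by rewrite -addn1 wpowD wpow1. Qed.

Lemma size_wpow u n : size (wpow u n) = n * size u.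
Proof. by elim: n => // n IHn; rewrite wpowS size_cat IHn mulSn. Qed.

Lemma count_wpow u n : count id (wpow u n) = n * count id u.
Proof. by elim: n => // n IHn; rewrite wpowS count_cat IHn mulSn. Qed.

Lemma rev_wpow u n : rev (wpow u n) = wpow (rev u) n.
Proof. by elim: n => // n IHn; rewrite wpowS rev_cat IHn -wpowSr. Qed.

Lemma prefix_ex u w : prefix u w -> exists v, w = u ++ v.
Proof. by case/prefixP=> v ->; exists v. Qed.

Lemma suffix_ex u w : suffix u w -> exists v, w = v ++ u.
Proof. by case/suffixP=> v ->; exists v. Qed.

Lemma leq_size_cat u v : size u <= size (u ++ v).
Proof. by rewrite size_cat leq_addr. Qed.

Lemma prefix_common u v w :
  prefix u w -> prefix v w -> size u <= size v -> prefix u v.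
Proof.
rewrite (prefixE v) prefixE => /eqP uw /eqP vw le_uv.
by rewrite prefixE -vw take_takel // uw.
Qed.

Lemma prefix_cat2l u v w : prefix (u ++ v) (u ++ w) = prefix v w.
Proof. by rewrite prefix_catr // eqxx. Qed.

Lemma suffix_common u v w :
  suffix u w -> suffix v w -> size u <= size v -> suffix u v.
Proof.
rewrite -!prefix_rev => uw vw le_uv.
by apply: prefix_common uw vw _; rewrite !size_rev.
Qed.

(** The letters in front of the suffix are as many as those of [x], hence of
    [v], and both they and [v] start the word [(v ++ u) ++ x]. *)
Lemma suffix_self_cat v u x :
  size v = size x -> suffix (v ++ u) ((v ++ u) ++ x) ->
  (v ++ u) ++ x = v ++ v ++ u.
Proof.
move=> sz_v /suffix_ex[e def_e]; rewrite def_e.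
have sz_e: size v == size e.
  by move/(congr1 (@size bool)): def_e; rewrite !size_cat; lia.
by move/eqP: def_e; rewrite -catA (eqseq_cat _ _ (eqP sz_e)) => /andP[/eqP-> _].
Qed.

(** Commuting words are powers of a common word, so they have the same
    frequency of [b].  The induction is Euclid's algorithm on the lengths. *)
Lemma commute_count u x :
  u ++ x = x ++ u -> count id u * size x = count id x * size u.
Proof.
move: {2}(size u + size x).+1 (ltnSn (size u + size x)) => n.
elim: n u x => // n IHn u x; rewrite ltnS => le_n uxC.
wlog le_ux: u x le_n uxC / size u <= size x.
  move=> IH; case: (leqP (size u) (size x)) => [|/ltnW] le; first exact: IH.
  by rewrite (IH x u) // addnC.
case: (posnP (size u)) => [/size0nil-> | u_gt0]; first by rewrite muln0.
have /prefix_ex[v def_x]: prefix u x.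
  apply: (@prefix_common _ _ (x ++ u)) le_ux; rewrite ?prefix_prefix //.
  by rewrite -uxC prefix_prefix.
have uvC: u ++ v = v ++ u.
  by move/eqP: uxC; rewrite def_x -catA eqseq_cat // eqxx => /eqP.
have := IHn u v; rewrite def_x size_cat count_cat.
rewrite def_x size_cat in le_n => /(_ _ uvC) IH.
by rewrite mulnDl mulnDr IH //; lia.
Qed.

(** Coprimality of the length and the number of [b]s makes [x] primitive: by
    equality of frequencies, the length of [x] divides that of every word
    commuting with [x].  Coprimality is what the recursion of the words [V]
    preserves visibly. *)
Lemma commute_wpow u x : coprime (size x) (count id x) ->
  u ++ x = x ++ u -> exists j, u = wpow x j.
Proof.
move=> x_prim uxC.
have: size x %| size u.
  by rewrite -(Gauss_dvdr _ x_prim) -(commute_count uxC) dvdn_mull.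
case/dvdnP=> j; elim: j u uxC => [|j IHj] u uxC def_u.
  by exists 0; apply: size0nil.
have /prefix_ex[v def]: prefix x u.
  apply: (@prefix_common _ _ (x ++ u)); rewrite -?uxC ?prefix_prefix //.
    by rewrite uxC prefix_prefix.
  by rewrite def_u mulSn leq_addr.
move: uxC def_u; rewrite def -catA => /eqP.
rewrite eqseq_cat // eqxx => /eqP uxC.
by rewrite size_cat mulSn => /addnI /(IHj _ uxC)[i ->]; exists i.+1.
Qed.

(** * Pairs of words that almost commute *)

(** [xy] and [yx] differ exactly by exchanging two adjacent distinct letters,
    sitting between [P] and [S]: this is how a pair of words that is the image
    of the two letters under a Sturmian morphism fails to commute. *)
Definition swap_at P S x y : Prop := exists c : bool,
  x ++ y = P ++ [:: c, ~~ c & S] /\ y ++ x = P ++ [:: ~~ c, c & S].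

Lemma swap_atC P S x y : swap_at P S x y -> swap_at P S y x.
Proof. by case=> c [xy yx]; exists (~~ c); rewrite negbK. Qed.

Lemma swap_at_size P S x y :
  swap_at P S x y -> size x + size y = size P + size S + 2.
Proof.
by case=> c [/(congr1 (@size bool))]; rewrite !size_cat /= => -> _; lia.
Qed.

Lemma swap_at_rev P S x y :
  swap_at P S x y -> swap_at (rev S) (rev P) (rev x) (rev y).
Proof.
case=> c [xy yx]; exists c; rewrite -!rev_cat xy yx !rev_cat !rev_cons.
by rewrite -!cats1 -!catA.
Qed.

(** Extending by powers of [x] moves the exchanged letters but does not affect
    them; this turns the pair (V_{i-1}, V_{i-2}) into (V_i, V_{i-1}). *)
Lemma swap_at_conj P S x y s t : swap_at P S x y ->
  swap_at (wpow x s ++ P) (S ++ wpow x t) x (wpow x s ++ y ++ wpow x t).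
Proof.
case=> c [xy yx]; exists c; split.
  by rewrite catA -wpowS wpowSr -!catA (catA x) xy -!catA.
by rewrite -!catA -wpowSr wpowS (catA y) yx -!catA.
Qed.

(** A factor of [w] of the length of [x] has the same number of [b]s as [x],
    with one exception: the factor [v] that ends at the first exchanged letter,
    where exactly one letter is flipped.  A border longer than [P] would contain
    [v], which would then occur in [w] a second time, further to the right. *)
Lemma swap_at_border_le P S x w u : swap_at P S x w ->
    0 < size x <= (size P).+1 ->
  prefix u w -> suffix u w -> size u < size w -> size u <= size P.
Proof.
move=> sw /andP[x_gt0 x_le] /prefix_ex[u1 def_w] /suffix_ex[z def_w'] lt_uw.
have sz := swap_at_size sw; case: sw => c [xw wx].
rewrite leqNgt; apply/negP => ltPu.
have /prefix_ex[u' def_u]: prefix (rcons P (~~ c)) u.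
  apply: (@prefix_common _ _ (w ++ x)); last by rewrite size_rcons.
    by rewrite wx -cat_rcons prefix_prefix.
  by rewrite def_w -catA prefix_prefix.
pose k := (size P).+1 - size x; pose g := take k P.
have szg : size g = k by rewrite size_takel // /k; lia.
pose v := rcons (drop k P) (~~ c).
have szv : size v = size x by rewrite size_rcons size_drop /k; lia.
have def_g b : rcons P b = g ++ rcons (drop k P) b.
  by rewrite -rcons_cat cat_take_drop.
(* With the letter [c] of [xw] instead of that of [wx], the window is a factor
   of a word of period [size x], so it is a conjugate of [x]. *)
have cnt_x : count id x = count id (rcons (drop k P) c).
  have : rcons P c = x ++ g.
    have /prefix_ex[r def]: prefix (x ++ g) (x ++ w).
      by rewrite def_w def_u def_g -!catA (catA x) prefix_prefix.
    have: prefix (x ++ g) (rcons P c).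
      apply: (@prefix_common _ _ (x ++ w)); first by rewrite def prefix_prefix.
        by rewrite xw -cat_rcons prefix_prefix.
      by rewrite size_cat size_rcons szg subnKC.
    rewrite prefixE take_oversize => [/eqP //|].
    by rewrite size_rcons size_cat szg subnKC.
  by rewrite def_g => /(congr1 (@count bool id)); rewrite !count_cat; lia.
(* [f] is the end of [w] starting at the second occurrence of [v]; it lies
   beyond the exchanged letters, where [w] is [x]-periodic from the right. *)
pose f := v ++ u'.
have def_u2: u = g ++ f by rewrite def_u def_g -catA.
have w_f : w = (z ++ g) ++ f by rewrite def_w' def_u2 catA.
have sz_w := congr1 (@size bool) w_f; have sz_w' := congr1 (@size bool) def_w'.
rewrite !size_cat szg in sz_w; rewrite size_cat in sz_w'.
have f_suf_S : suffix f S.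
  apply: (@suffix_common _ _ (x ++ w)).
  - by rewrite w_f catA suffix_suffix.
  - by rewrite xw -(cat1s c) -(cat1s (~~ c)) !catA suffix_suffix.
  - by move: sz_w; rewrite /f size_cat /k; lia.
have /(suffix_self_cat szv): suffix f (f ++ x).
  apply: (@suffix_common _ _ (w ++ x)).
  - apply: suffix_trans f_suf_S _.
    by rewrite wx -(cat1s c) -(cat1s (~~ c)) !catA suffix_suffix.
  - by rewrite w_f -(catA (z ++ g)) suffix_suffix.
  - by rewrite size_cat leq_addr.
rewrite -catA => /(congr1 (@count bool id)); rewrite !count_cat.
have: count id v <> count id (rcons (drop k P) c).
  by rewrite /v -!cats1 !count_cat /=; case: (c) => /=; lia.
lia.
Qed.

(** Up to the exchanged letters [w] is [x]-periodic from the left, and after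
    them it is [x]-periodic from the right.  A border long enough to contain [x]
    avoids them in both of its occurrences; it starts with [x] and has period
    [size x] aligned with the end of [x], so it commutes with [x]. *)
Lemma swap_at_border P S x w u : swap_at P S x w ->
    coprime (size x) (count id x) ->
    size x <= (size P).+1 -> size x <= (size S).+1 ->
  border u w -> size x <= size u ->
  exists2 j, u = wpow x j & j * size x <= minn (size P) (size S).
Proof.
move=> sw x_prim leP leS /and4P[_ pre neq suf] le_xu.
have x_gt0: 0 < size x by case: (x) x_prim.
have lt_uw: size u < size w.
  rewrite ltn_neqAle size_prefix // andbT; apply: contra neq => /eqP eq_sz.
  by move: pre; rewrite prefixE eq_sz take_size => /eqP->.
have uP := swap_at_border_le sw _ pre suf lt_uw.
have {}uP: size u <= size P by rewrite uP // x_gt0.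
(* Reversing all words exchanges the roles of [P] and [S]. *)
have uS := swap_at_border_le (swap_at_rev sw) _ _ _ _.
have {uS} := uS (rev u).
rewrite !size_rev x_gt0 leS prefix_rev suffix_rev pre suf lt_uw.
move=> /(_ isT isT isT isT) uS.
case: sw => c [xw wx].
have uPpre : prefix u P.
  apply: (@prefix_common _ _ (w ++ x)) => //.
    by apply: prefix_trans pre _; rewrite prefix_prefix.
  by rewrite wx prefix_prefix.
have /prefix_ex[u' def_u]: prefix x u.
  apply: (@prefix_common _ _ (x ++ w)) => //; first exact: prefix_prefix.
  by apply: prefix_trans uPpre _; rewrite xw prefix_prefix.
have sufS : suffix u S.
  apply: (@suffix_common _ _ (x ++ w)) => //.
    by apply: suffix_trans suf _; rewrite suffix_suffix.
  by rewrite xw -(cat1s c) -(cat1s (~~ c)) !catA suffix_suffix.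
have uxC: u ++ x = x ++ u.
  rewrite def_u; apply: suffix_self_cat => //; rewrite -def_u.
  apply: (@suffix_common _ _ (w ++ x)).
  - apply: suffix_trans sufS _.
    by rewrite wx -(cat1s c) -(cat1s (~~ c)) !catA suffix_suffix.
  - by case/suffix_ex: suf => z ->; rewrite -catA suffix_suffix.
  - by rewrite size_cat leq_addr.
have [j def_j] := commute_wpow x_prim uxC.
by exists j => //; rewrite leq_min -size_wpow -def_j uP uS.
Qed.

Lemma swap_at_prefix_wpow P S x w j : swap_at P S x w ->
  j * size x <= size P -> j * size x <= size w -> prefix (wpow x j) w.
Proof.
case=> c [xw wx]; elim: j => [|j IHj] leP lew; first exact: prefix0s.
have {}IHj: prefix (wpow x j) w by apply: IHj; lia.
have preP : prefix (wpow x j.+1) P.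
  apply: (@prefix_common _ _ (x ++ w)); last by rewrite size_wpow.
    by rewrite wpowS prefix_cat2l.
  by rewrite xw prefix_prefix.
apply: (@prefix_common _ _ (w ++ x)); last by rewrite size_wpow.
  by apply: prefix_trans preP _; rewrite wx prefix_prefix.
exact: prefix_prefix.
Qed.

(** Conversely every power of [x] that fits into both [P] and [S] is a border,
    so the longest border is the largest such power. *)
Lemma longest_border_wpow P S x w : swap_at P S x w ->
    coprime (size x) (count id x) ->
    size x <= (size P).+1 -> size x <= (size S).+1 ->
  let j := minn (size P %/ size x) (size S %/ size x) in
  0 < j -> longest_border (wpow x j) w.
Proof.
move=> sw x_prim leP leS j j_gt0.
have x_gt0: 0 < size x by case: (x) x_prim.
have jP: j * size x <= size P by rewrite -leq_divRL // geq_minl.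
have jS: j * size x <= size S by rewrite -leq_divRL // geq_minr.
have sz := swap_at_size sw.
have le_xj: size x <= j * size x by rewrite leq_pmull.
split=> [|u u_border].
  apply/and4P; split.
  - by rewrite -size_eq0 size_wpow -lt0n (leq_trans x_gt0).
  - by apply: swap_at_prefix_wpow sw _ _ => //; lia.
  - by apply/eqP => /(congr1 (@size bool)); rewrite size_wpow; lia.
  - rewrite -prefix_rev rev_wpow.
    by apply: swap_at_prefix_wpow (swap_at_rev sw) _ _;
       rewrite !size_rev //; lia.
rewrite size_wpow leqNgt; apply/negP => lt_ju.
have [|i def_u] := swap_at_border sw x_prim leP leS u_border.
  exact: leq_trans le_xj (ltnW lt_ju).
rewrite leq_min -!leq_divRL // -leq_min -/j => le_ij.
move: lt_ju; rewrite def_u size_wpow ltn_pmul2r //; lia.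
Qed.

(** If [S] is too short, the exchanged letters of [wx] lie beyond [w], and [w]
    has period [size x]. *)
Lemma swap_at_short P S x w : swap_at P S x w -> (size S).+1 < size x ->
  prefix w (x ++ w).
Proof.
move=> sw lt_S; have sz := swap_at_size sw; case: sw => c [xw wx].
apply: (@prefix_trans _ P); last by rewrite xw prefix_prefix.
apply: (@prefix_common _ _ (w ++ x)); rewrite ?prefix_prefix //; last by lia.
by rewrite wx prefix_prefix.
Qed.

(** A word with period [size x] and length at least twice that has no smaller
    period when [x] is primitive: a border longer than [v] would place an
    occurrence of [x] inside [xx] at a nontrivial position. *)
Lemma longest_border_periodic x w v : coprime (size x) (count id x) ->
    w = x ++ v -> prefix w (x ++ w) -> size x <= size v ->
  longest_border v w.
Proof.
move=> x_prim def_w w_per le_xv.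
have x_gt0: 0 < size x by case: (x) x_prim.
have pre_vw: prefix v w.
  by move: w_per; rewrite {1}def_w prefix_cat2l.
suff max u : border u w -> size u <= size v.
  split=> [|u]; last exact: max.
  apply/and4P; split=> //; last by rewrite def_w suffix_suffix.
    by rewrite -size_eq0 -lt0n (leq_trans x_gt0).
  by apply/eqP=> /(congr1 (@size bool)); rewrite def_w size_cat; lia.
case/and4P=> _ pre neq /suffix_ex[z def_z].
rewrite leqNgt; apply/negP => lt_vu.
have sz: size z + size u = size x + size v by rewrite -!size_cat -def_z def_w.
have pre_x u1 : prefix u1 w -> size x <= size u1 -> prefix x u1.
  move=> p; apply: prefix_common p; rewrite ?def_w ?prefix_prefix //.
have zx_w : prefix (z ++ x) w.
  by rewrite def_z prefix_cat2l pre_x //; lia.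
have z_x : prefix z x.
  apply: (@prefix_common _ _ w); rewrite ?def_w ?prefix_prefix //; last by lia.
  by rewrite -def_w def_z prefix_prefix.
case/prefix_ex: z_x => y def_x.
have zxC: z ++ x = x ++ z.
  have zx_xx: prefix (z ++ x) (x ++ x).
    apply: (@prefix_common _ _ w) => //; last by rewrite !size_cat; lia.
    by rewrite def_w prefix_cat2l pre_x.
  have: prefix (x ++ z) (x ++ x) by rewrite prefix_cat2l def_x prefix_prefix.
  move/prefix_common=> /(_ _ zx_xx); rewrite !size_cat addnC leqnn => /(_ isT).
  by rewrite prefixE take_oversize ?size_cat 1?addnC // => /eqP.
have [[|j] def] := commute_wpow x_prim zxC.
  by move: neq; rewrite def_z def eqxx.
move/(congr1 (@size bool)): def; rewrite size_wpow mulSn; nia.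
Qed.

(** * Where the words V_i and V_{i-1} fail to commute *)

(** The word V_{i-1}, including V_{-1} = b. *)
Definition Vprev a d i : seq bool := if i is j.+1 then V a d j else [:: lb].

(** The words around the exchanged letters of the products of V_i and V_{i-1},
    as given by [swap_at_conj].  When all digits are admissible, the length of
    [swap_right a d i] is d_1 q_0 + ... + d_i q_{i-1}, the integer represented by
    d_1, ..., d_i. *)
Fixpoint swap_left a d i : seq bool :=
  if i is j.+1 then wpow (V a d j) (bcoef a i - d i) ++ swap_left a d j
  else [::].

Fixpoint swap_right a d i : seq bool :=
  if i is j.+1 then swap_right a d j ++ wpow (V a d j) (d i) else [::].

Lemma V_S a d j :
  V a d j.+1 = wpow (V a d j) (bcoef a j.+1 - d j.+1) ++ Vprev a d j
               ++ wpow (V a d j) (d j.+1).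
Proof. by []. Qed.

Lemma swap_at_V a d j :
  swap_at (swap_left a d j) (swap_right a d j) (Vprev a d j) (V a d j).
Proof.
elim: j => [|j IHj]; first by exists true.
exact/swap_at_conj/swap_atC.
Qed.

(** The incidence matrix of the morphism defining V_i and V_{i-1} is a product
    of unimodular matrices, so it has determinant 1 or -1. *)
Lemma count_V_det a d j : let x : seq bool := V a d j in let y := Vprev a d j in
  size x * count id y = (size y * count id x).+1 \/
  size y * count id x = (size x * count id y).+1.
Proof.
elim: j => [|j /= IHj]; first by left.
rewrite -/(Vprev a d j) !size_cat !count_cat !size_wpow !count_wpow; nia.
Qed.

Lemma coprime_V a d j :
  coprime (size (V a d j : seq bool)) (count id (V a d j)).
Proof.
set x : seq bool := V a d j; rewrite /coprime -dvdn1; have := count_V_det a d j.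
have gx := dvdn_gcdl (size x) (count id x).
have gc := dvdn_gcdr (size x) (count id x).
move=> /= [] det.
- rewrite -(@dvdn_addr _ _ 1 (dvdn_mull (size (Vprev a d j)) gc)) addn1 -det.
  by rewrite dvdn_mulr.
- rewrite -(@dvdn_addr _ _ 1 (dvdn_mulr (count id (Vprev a d j)) gx)) addn1.
  by rewrite -det dvdn_mull.
Qed.

(** * Greedy representations *)

Definition greedy_upto a d m : Prop :=
  (forall i, 1 <= i <= m -> d i <= bcoef a i) /\
  (forall i, 2 <= i <= m -> d i = bcoef a i -> d i.-1 = 0).

Lemma greedy_uptoW a d n m : n <= m -> greedy_upto a d m -> greedy_upto a d n.
Proof. by move=> le_nm [db gr]; split=> i ?; [apply: db | apply: gr]; lia. Qed.

Lemma V_size_gt0 a d j : 0 < size (V a d j : seq bool).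
Proof. by have := coprime_V a d j; case: (V a d j). Qed.

Lemma V_sizeS a d j : d j.+1 <= bcoef a j.+1 ->
  size (V a d j.+1 : seq bool) =
    bcoef a j.+1 * size (V a d j : seq bool) + size (Vprev a d j).
Proof. by move=> le_db; rewrite V_S !size_cat !size_wpow; nia. Qed.

Lemma swap_right_sizeS a d j : size (swap_right a d j.+1) =
  d j.+1 * size (V a d j : seq bool) + size (swap_right a d j).
Proof. by rewrite size_cat size_wpow addnC. Qed.

(** A greedy representation with i digits represents an integer less than q_i:
    a maximal leading digit forces the next one to vanish. *)
Lemma swap_right_lt a d j : greedy_upto a d j ->
  size (swap_right a d j) < size (V a d j : seq bool).
Proof.
elim/ltn_ind: j => -[|[|j]] // IH gr; have [db g0] := gr.
  rewrite swap_right_sizeS V_sizeS ?db //=; have := db 1 isT; lia.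
have lt_j1 := IH j.+1 (leqnn _) (greedy_uptoW (leqnSn _) gr).
have lt_j := IH j (leqnSn _) (greedy_uptoW (ltnW (leqnSn _)) gr).
have db2 : d j.+2 <= bcoef a j.+2 by apply: db; lia.
rewrite swap_right_sizeS (@V_sizeS a d j.+1) // [size (Vprev _ _ _)]/=.
case: (eqVneq (d j.+2) (bcoef a j.+2)) => [eq_db | neq_db].
  have d0 : d j.+1 = 0 by apply: (g0 j.+2) eq_db; lia.
  by rewrite eq_db ltn_add2l swap_right_sizeS d0.
have lt_db : d j.+2 < bcoef a j.+2 by rewrite ltn_neqAle neq_db.
by apply: (leq_trans (n := (d j.+2).+1 * size (V a d j.+1 : seq bool))); nia.
Qed.

(** The digits are maximal at the indices of parity [o] and vanish at the
    others. *)
Definition alt_from a d (o : bool) k : Prop :=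
  forall i, 1 <= i <= k -> d i = if odd i == o then bcoef a i else 0.

Lemma alternatingP a d k : alternating a d k <-> exists o, alt_from a d o k.
Proof.
split=> [[] alt | [[] alt]].
- by exists true => i /alt->; case: odd.
- by exists false => i /alt->; case: odd.
- by left=> i /alt->; case: odd.
- by right=> i /alt->; case: odd.
Qed.

Lemma alt_fromS a d o k : alt_from a d o k.+1 <->
  alt_from a d o k /\ d k.+1 = if odd k.+1 == o then bcoef a k.+1 else 0.
Proof.
split=> [alt | [alt def_d] i /andP[i_gt0]].
  by split=> [i le_i|]; apply: alt; lia.
by rewrite leq_eqVlt => /orP[/eqP-> // | le_ik]; apply: alt; rewrite i_gt0.
Qed.

(** The representation of q_j - 1 is the one whose digits alternate downwards
    from a maximal d_j. *)
Lemma swap_right_max a d j : greedy_upto a d j ->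
  (size (swap_right a d j)).+1 = size (V a d j : seq bool) <->
  alt_from a d (odd j) j.
Proof.
elim/ltn_ind: j => -[|[|j]] IH gr; have [db g0] := gr.
- by split=> // _ i; case: i.
- rewrite swap_right_sizeS V_sizeS ?db //= alt_fromS /=.
  split=> [def|[_ ->]]; last by lia.
  by split=> [i|]; [case: i | lia].
have {IH} := IH j (leqnSn _) (greedy_uptoW (ltnW (leqnSn _)) gr).
have lt_j1 := swap_right_lt (greedy_uptoW (leqnSn _) gr).
have V_gt0 := V_size_gt0 a d j.
have db2 : d j.+2 <= bcoef a j.+2 by apply: db; lia.
rewrite swap_right_sizeS (@V_sizeS a d j.+1) // [size (Vprev _ _ _)]/=.
rewrite !alt_fromS !oddS negbK eqxx.
have ->: ~~ odd j == odd j = false by case: odd.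
move=> IH; split=> [def | [[alt d1] ->]]; last first.
  by rewrite swap_right_sizeS d1 -IH in alt *; lia.
have eq_db : d j.+2 = bcoef a j.+2.
  apply/eqP; rewrite eqn_leq db2 leqNgt; apply/negP => lt_db.
  have := leq_mul lt_db (leqnn (size (V a d j.+1 : seq bool))).
  rewrite mulSn; lia.
have d1 : d j.+1 = 0 by apply: (g0 j.+2) eq_db; lia.
split=> //; split=> //; apply/IH.
by move: def; rewrite swap_right_sizeS d1 eq_db; lia.
Qed.

(** * Alternating digits give Christoffel words *)

Definition morphic (h : word -> word) := {morph h : u v / u ++ v}.

Lemma morph_cat u v : morphic (morph u v).
Proof. by move=> w1 w2; rewrite /morph map_cat flatten_cat. Qed.

(** For [x = a] (resp. [b]), [f] is one of the four generators that fix [x] and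
    send the other letter [y] to [xy] or [yx]; composing with [f] on the right
    [n] times adjoins the [n]-th power of [h x] on one side of [h y]. *)
Lemma morphic_iter (C : (word -> word) -> Prop) (f h : word -> word)
    (x y l : bool) n :
    (forall h, C h -> C (h \o f)) -> morphic f ->
    f [:: x] = [:: x] -> f [:: y] = (if l then [:: x; y] else [:: y; x]) ->
    C h -> morphic h ->
  exists h', [/\ C h', morphic h', h' [:: x] = h [:: x] &
    h' [:: y] = if l then wpow (h [:: x]) n ++ h [:: y]
                else h [:: y] ++ wpow (h [:: x]) n].
Proof.
move=> Cf f_mor fx fy Ch h_mor; elim: n => [|n [h' [Ch' h'_mor h'x h'y]]].
  by exists h; split=> //; case: l {fy}; rewrite ?cats0.
exists (h' \o f); split; first exact: Cf.
- by move=> u v; rewrite /= f_mor h'_mor.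
- by rewrite /= fx.
rewrite /= fy; case: l {fy} h'y => h'y.
  by rewrite (h'_mor [:: x] [:: y]) h'x h'y catA -wpowS.
by rewrite (h'_mor [:: y] [:: x]) h'x h'y -catA -wpowSr.
Qed.

(** With alternating digits, V_{k+1} is obtained from V_{k-1} by adjoining
    V_k^{b_{k+1}} on a side that depends only on the parity of k.  So the pair
    formed by V_k and V_{k-1} is the image of the letters under a product of
    powers of two generators, which are either G~ and D or G and D~. *)
Lemma alternating_christoffel a d k :
  alternating a d k -> christoffel (V a d k).
Proof.
case/alternatingP=> o.
pose f := if o then mGt else mG; pose g := if o then mD else mDt.
move=> alt; suff [h Ch hV]: exists2 h, generated2 f g h &
    V a d k = h [:: la] \/ V a d k = h [:: lb].
  by case: o @f @g {alt} Ch => f g Ch; [right | left]; exists h.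
suff [h [Ch _ ha hb]] : exists h, [/\ generated2 f g h, morphic h,
    h [:: la] = (if odd k then Vprev a d k else V a d k) &
    h [:: lb] = (if odd k then V a d k else Vprev a d k)].
  by exists h => //; rewrite ha hb; case: odd; [right | left].
elim: k alt => [_|k IHk /alt_fromS[/IHk[h [Ch h_mor ha hb]] def_d]].
  by exists id; split=> //; apply: gen_id.
have Cf h' : generated2 f g h' -> generated2 f g (h' \o f).
  by move=> Ch'; apply: gen_comp Ch' (gen_l _ _).
have Cg h' : generated2 f g h' -> generated2 f g (h' \o g).
  by move=> Ch'; apply: gen_comp Ch' (gen_r _ _).
have f_mor : morphic f by rewrite /f; case: (o); apply: morph_cat.
have g_mor : morphic g by rewrite /g; case: (o); apply: morph_cat.
rewrite V_S def_d /=; case: (boolP (odd k)) ha hb => /= odd_k ha hb.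
- have [||h' [Ch' h'_mor h'b h'a]] :=
    morphic_iter (x := lb) (y := la) (l := o) (bcoef a k.+1)
                 Cg g_mor _ _ Ch h_mor.
  + by rewrite /g; case: (o).
  + by rewrite /g; case: (o).
  exists h'; split; rewrite ?h'a ?h'b // ha hb.
  by case: (o); rewrite /= ?subn0 ?subnn ?cats0.
- have [||h' [Ch' h'_mor h'a h'b]] :=
    morphic_iter (x := la) (y := lb) (l := ~~ o) (bcoef a k.+1)
                 Cf f_mor _ _ Ch h_mor.
  + by rewrite /f; case: (o).
  + by rewrite /f; case: (o).
  exists h'; split; rewrite ?h'a ?h'b // ha hb.
  by case: (o); rewrite /= ?subn0 ?subnn ?cats0.
Qed.

(** * The borders of V_i *)

Lemma alt_from_alternating a d k :
  alt_from a d (odd k) k -> alternating a d k.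
Proof. by move=> alt; apply/alternatingP; exists (odd k). Qed.

(** The digit d_{k+1} = 0 tells which of the two alternating sequences is meant,
    unless b_{k+1} = 0 too; for k = 0 there is nothing left to distinguish. *)
Lemma alternatingS0 a d k : (0 < k -> 0 < bcoef a k.+1) -> d k.+1 = 0 ->
  alternating a d k.+1 <-> alt_from a d (odd k) k.
Proof.
move=> b_gt0 d0; split=> [/alternatingP[o /alt_fromS[alt]] | alt].
  case: k b_gt0 d0 alt => [|k] b_gt0 d0 alt; first by move=> _ [].
  rewrite d0; case: eqP => [_ b0 | /eqP neq _].
    by have := b_gt0 isT; rewrite -b0.
  suff -> : odd k.+1 = o by [].
  by move: neq; rewrite /=; case: (o); case: odd.
apply/alternatingP; exists (odd k); apply/alt_fromS; split=> //.
by rewrite d0 /=; case: odd.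
Qed.

Lemma alternatingSS a d k : (0 < k -> 0 < bcoef a k.+1) -> d k.+1 = 0 ->
  alternating a d k.+1 -> d k.+2 = bcoef a k.+2 -> alt_from a d (odd k) k.+2.
Proof.
move=> b_gt0 d0 /(alternatingS0 b_gt0 d0) alt d_max.
by rewrite !alt_fromS !oddS negbK eqxx d0; case: odd alt.
Qed.

(** Whether [swap_left] is long enough to contain one more copy of V_j: this is
    the source of the exceptional cases in which the exponent of the border
    grows by one. *)
Definition long_left a d j : bool :=
  size (V a d j : seq bool) <= size (swap_left a d j).

(** As the two parts and the two exchanged letters add up to V_j and V_{j-1},
    the left part contains V_j when the right part is shorter than V_{j-1} by at
    least 2.  The right part has the length of the integer represented by
    d_1, ..., d_j, so d_j must vanish, and the remaining digits must represent
    an integer other than q_{j-1} - 1. *)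
Lemma long_leftP a d j : greedy_upto a d j ->
    (forall i, 2 <= i <= j -> 0 < bcoef a i) ->
  long_left a d j <-> [/\ 0 < j, d j = 0 & ~ alternating a d j].
Proof.
case: j => [|j] gr b_gt0; first by split=> // -[].
have bj : 0 < j -> 0 < bcoef a j.+1 by move=> j0; apply: b_gt0; lia.
have grj := greedy_uptoW (leqnSn j) gr.
have lt_j := swap_right_lt grj.
have sz := swap_at_size (swap_at_V a d j.+1).
have eq_sz := swap_right_max grj.
rewrite [size (Vprev _ _ _)]/= swap_right_sizeS in sz.
rewrite /long_left; split=> [le_VL | [_ d0 nalt]].
  have d0 : d j.+1 = 0 by nia.
  split=> //; rewrite (alternatingS0 bj d0) => /eq_sz.
  by rewrite d0 in sz; lia.
rewrite d0 in sz; rewrite (alternatingS0 bj d0) -eq_sz in nalt.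
by lia.
Qed.

(** A maximal digit d_{j+1} forces d_j = 0, and then an alternating sequence
    d_1, ..., d_j would extend to d_{j+1}. *)
Lemma long_left_max a d j : greedy_upto a d j.+1 ->
    (forall i, 2 <= i <= j -> 0 < bcoef a i) ->
    d j.+1 = bcoef a j.+1 -> ~ alt_from a d (odd j.+1) j.+1 ->
  long_left a d j.
Proof.
move=> gr b_gt0 d_max nalt; apply/long_leftP => //.
  exact: greedy_uptoW (leqnSn j) gr.
case: j gr b_gt0 d_max nalt => [|j] [_ g0] b_gt0 d_max nalt.
  by case: nalt; apply/alt_fromS; split=> // i; case: i.
have d0 : d j.+1 = 0 by apply: (g0 j.+2) => //; lia.
split=> // alt; apply: nalt; rewrite !oddS negbK.
by apply: alternatingSS alt d_max => // j_gt0; apply: b_gt0; lia.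
Qed.

Lemma swap_left_div a d j : (0 < j -> d j <= bcoef a j) ->
    (1 < j -> 0 < bcoef a j) ->
  size (swap_left a d j) %/ size (V a d j : seq bool) = long_left a d j.
Proof.
move=> db b_gt0; have V_gt0 := V_size_gt0 a d j.
have sz := swap_at_size (swap_at_V a d j).
have le_V : size (Vprev a d j) <= size (V a d j : seq bool).
  case: j db b_gt0 {V_gt0 sz} => // j db b_gt0; rewrite V_sizeS ?db //=.
  case: j db b_gt0 => [|j] db b_gt0; first by rewrite addn1.
  by have := b_gt0 isT; nia.
rewrite /long_left; case: leqP => [le|lt]; last exact: divn_small.
rewrite -[size (swap_left _ _ _)](subnKC le) divnDl // divnn V_gt0.
by rewrite divn_small //; lia.
Qed.

(** The digits d_1, ..., d_j represent an integer less than q_j, so V_j fits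
    exactly [t] times on the right of the exchanged letters; on the left it fits
    [s] times, or once more if [swap_left] is long. *)
Lemma longest_border_V_split a d j s t (w : seq bool) :
    greedy_upto a d j -> (1 < j -> 0 < bcoef a j) ->
    w = wpow (V a d j) s ++ Vprev a d j ++ wpow (V a d j) t ->
    size (swap_right a d j ++ wpow (V a d j) t) < size w ->
    0 < minn (s + long_left a d j) t ->
  longest_border (wpow (V a d j) (minn (s + long_left a d j) t)) w.
Proof.
move=> gr b_gt0 def_w le_w j_gt0.
pose x : seq bool := V a d j.
have x_gt0 : 0 < size x := V_size_gt0 a d j.
have sw : swap_at (wpow x s ++ swap_left a d j)
                  (swap_right a d j ++ wpow x t) x w.
  by rewrite def_w; apply/swap_at_conj/swap_atC/swap_at_V.
have lt_j := swap_right_lt gr.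
have t_gt0 : 0 < t by lia.
have divL : size (wpow x s ++ swap_left a d j) %/ size x = s + long_left a d j.
  rewrite size_cat size_wpow divnMDl // swap_left_div //.
  by move=> j0; case: gr => db _; apply: db; rewrite j0 leqnn.
have divR : size (swap_right a d j ++ wpow x t) %/ size x = t.
  by rewrite size_cat size_wpow addnC divnMDl // divn_small // addn0.
rewrite -divL -divR; apply: (longest_border_wpow sw).
- exact: coprime_V.
- by move: le_w; rewrite -/x; have := swap_at_size sw; lia.
- by apply: leqW; rewrite size_cat size_wpow -/x; nia.
- by rewrite divL divR.
Qed.

Theorem theorem8p1 (m : nat) (a : nat -> nat)
  (a_gt0 : forall i, 1 <= i <= m -> 0 < a i)
  (m_cond : 3 <= m \/ (m = 2 /\ 1 <= bcoef a 1))
  (N : nat) (N_le : N <= q a m - 1)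
  (d : nat -> nat) (d_greedy : greedy_repr a m N d)
  (Vm_nonchristoffel : ~ christoffel (V a d m)) :
  let b := bcoef a in
  let Vm := V a d m in
  let Vm1 := V a d (m - 1) in
  let Vm2 := V a d (m - 2) in
  let l := minn (b m - d m) (d m) in
  let h := minn (b (m - 1) - d (m - 1)) (d (m - 1) + 1) in
  let exc_iii := b m - d m < d m /\ ~ alternating a d (m - 1) in
  let exc_vi := [/\ 3 <= m, d (m - 2) = 0,
                    b (m - 1) - d (m - 1) < d (m - 1) + 1 &
                    ~ alternating a d (m - 2)] in
  exists2 B : word, longest_border B Vm &
    (* i *)
    (d m = b m -> B = Vm1) /\
    (* ii *)
    (1 <= d m <= b m - 1 -> 1 <= d (m - 1) <= b (m - 1) - 1 ->
       B = wpow Vm1 l) /\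
    (* iii *)
    (1 <= d m <= b m - 1 -> d (m - 1) = 0 ->
       (~ exc_iii -> B = wpow Vm1 l) /\ (exc_iii -> B = wpow Vm1 (l + 1))) /\
    (* iv *)
    (1 <= d m <= b m - 1 -> d (m - 1) = b (m - 1) -> B = wpow Vm1 l) /\
    (* v *)
    (d m = 0 -> 2 <= b m -> B = wpow Vm1 (b m - 1) ++ Vm2) /\
    (* vi *)
    (d m = 0 -> b m = 1 -> 1 <= b (m - 1) - d (m - 1) ->
       (~ exc_vi -> B = wpow Vm2 h) /\ (exc_vi -> B = wpow Vm2 (h + 1))) /\
    (* vii *)
    (d m = 0 -> b m = 1 -> d (m - 1) = b (m - 1) -> B = Vm2).
Proof.
case: d_greedy => _ db g0; have gr : greedy_upto a d m by [].
have b_gt0 i : 2 <= i <= m -> 0 < bcoef a i.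
  by case: i => [|[|i]] // le_im; apply: a_gt0; lia.
have b1_gt0 : m = 2 -> 0 < bcoef a 1 by case: m_cond => [|[]] //; lia.
have nalt : ~ alternating a d m by move/alternating_christoffel.
case: m m_cond a_gt0 db g0 gr b_gt0 b1_gt0 nalt {N_le Vm_nonchristoffel}
  => [|[|j]]; try lia.
move=> _ _ db g0 gr b_gt0 b1_gt0 nalt b Vm Vm1 Vm2 l h exc_iii exc_vi.
have bj1 : 0 < bcoef a j.+1.
  case: (posnP j) => [j0 | j_gt0]; last by apply: b_gt0; lia.
  by rewrite j0; apply: b1_gt0; rewrite j0.
have bj2 : 0 < bcoef a j.+2 by apply: b_gt0; lia.
have db2 : d j.+2 <= bcoef a j.+2 by apply: db; lia.
have db1 : d j.+1 <= bcoef a j.+1 by apply: db; lia.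
have gr1 := greedy_uptoW (leqnSn _) gr; have gr0 := greedy_uptoW (leqnSn _) gr1.
have e1 : j.+2 - 1 = j.+1 by lia.
have e2 : j.+2 - 2 = j by lia.
rewrite {}/Vm1 {}/Vm2 {}/h {}/exc_iii {}/exc_vi e1 e2 {e1 e2}.
have long1 : long_left a d j.+1 <-> d j.+1 = 0 /\ ~ alternating a d j.+1.
  rewrite long_leftP //; first by split=> [[]|[]].
  by move=> i le_i; apply: b_gt0; lia.
have long0 : long_left a d j <-> [/\ 0 < j, d j = 0 & ~ alternating a d j].
  by apply: long_leftP => // i le_i; apply: b_gt0; lia.
case: (posnP (d j.+2)) => [d0 | d_gt0]; last first.
  (* Both parts around the exchanged letters can hold V_{m-1}; when d_m = b_m,
     the left one does only because the digits do not alternate. *)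
  have long_max : d j.+2 = bcoef a j.+2 -> long_left a d j.+1.
    move=> d_max; apply: long_left_max gr _ d_max _.
      by move=> i le_i; apply: b_gt0; lia.
    by move/alt_from_alternating.
  exists (wpow (V a d j.+1)
               (minn (b j.+2 - d j.+2 + long_left a d j.+1) (d j.+2))).
    apply: longest_border_V_split => //; first exact: (swap_right_lt gr).
    rewrite leq_min d_gt0 andbT addn_gt0 subn_gt0 ltn_neqAle db2 andbT.
    by case: eqP => //= /long_max->.
  rewrite {}/l {}/b; split=> [d_max|].
    rewrite [X in wpow _ X](_ : _ = 1) ?wpow1 // long_max //.
    by rewrite -d_max; lia.
  have short : d j.+1 <> 0 -> long_left a d j.+1 = false.
    by move=> d_neq0; apply/negP => /long1[].
  split=> [_ d1|]; first by rewrite short ?addn0 //; lia.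
  split=> [_ d1|].
    split=> [nexc | [lt nalt1]]; congr wpow; last first.
      have -> : long_left a d j.+1 by apply/long1.
      by rewrite /=; lia.
    case: (boolP (long_left _ _ _)) => [/long1[_ nalt1] | _].
      have: ~ bcoef a j.+2 - d j.+2 < d j.+2 by move=> lt; apply: nexc.
      by rewrite /=; lia.
    by rewrite addn0.
  split=> [_ d1|]; first by rewrite short ?addn0 // d1; lia.
  by split=> [d0|]; [|split=> d0]; move: d_gt0; rewrite d0.
have nalt1 : ~ alt_from a d (odd j.+1) j.+1.
  by move/(alternatingS0 (fun _ => bj2) d0).
have [b_gt1 | b_le1] := leqP 2 (bcoef a j.+2).
  (* The digits do not alternate, so the part on the right is shorter than
     V_{m-1} by at least 2, and V_m has period q_{m-1}. *)
  have lt_N : (size (swap_right a d j.+1)).+1 < size (V a d j.+1 : seq bool).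
    rewrite ltn_neqAle (swap_right_lt gr1) andbT.
    by apply/eqP => /(swap_right_max gr1).
  exists (wpow (V a d j.+1) (b j.+2 - 1) ++ Vprev a d j.+1).
    apply: longest_border_periodic (coprime_V a d j.+1) _ _ _.
    - rewrite {}/Vm V_S d0 subn0 cats0 catA -wpowS /b.
      by congr (wpow _ _ ++ _); lia.
    - apply: (swap_at_short (swap_at_V a d j.+2)).
      by rewrite swap_right_sizeS d0.
    - rewrite -[X in X - 1](subnK b_gt1) addn2 subn1 -catA.
      exact: leq_size_cat.
  rewrite /b; split=> [|]; first by move=> b0; rewrite -b0 d0 in b_gt1.
  do 3![split=> [|]; first by rewrite d0].
  by split=> //; split=> _ b1; move: b_gt1; rewrite b1.
(* Now V_m = V_{m-1} V_{m-2}, which is again a power of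
   V_{m-2}, then V_{m-3}, then a power of V_{m-2}, with the last exponent
   increased by one. *)
have b1 : bcoef a j.+2 = 1 by lia.
have min_gt0 : 0 < minn (b j.+1 - d j.+1 + long_left a d j) (d j.+1).+1.
  rewrite leq_min andbT addn_gt0 subn_gt0 ltn_neqAle db1 andbT.
  case: eqP => //= d_max; rewrite lt0b; apply: long_left_max gr1 _ d_max nalt1.
  by move=> i le_i; apply: b_gt0; lia.
exists (wpow (V a d j) (minn (b j.+1 - d j.+1 + long_left a d j) (d j.+1).+1)).
  apply: longest_border_V_split => //; first by move=> ?; apply: b_gt0; lia.
  - by rewrite {}/Vm V_S d0 b1 cats0 wpow1 V_S -!catA -wpowSr.
  - have := swap_right_lt gr1; rewrite -(ltn_add2r (size (V a d j : seq bool))).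
    by rewrite -!size_cat -catA -wpowSr {}/Vm (V_S a d j.+1) d0 b1 cats0 wpow1.
rewrite /b; split=> [|]; first by rewrite d0 b1.
do 3![split=> [|]; first by rewrite d0].
split; first by rewrite b1.
split=> [_ _ d_lt | _ _ d_max]; last first.
  rewrite [X in wpow _ X](_ : _ = 1) ?wpow1 //.
  by move: min_gt0; rewrite d_max subnn; case: long_left; lia.
split=> [nexc | [j_ge dj0 lt nalt0]]; congr wpow; last first.
  have -> : long_left a d j by apply/long0; split=> //; lia.
  by rewrite /=; lia.
case: (boolP (long_left _ _ _)) => [/long0[j_gt0 dj0 nalt0] | _].
  have: ~ bcoef a j.+1 - d j.+1 < d j.+1 + 1.
    by move=> lt; apply: nexc; split=> //; lia.
  by rewrite /=; lia.
by rewrite addn0 addn1.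
Qed.
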